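(* Let $I$ be a non-empty subset of $\mathbb{N}$ and let $S\subseteq\mathbb{N}^{(I)}$ be a gap absorbing monoid. Then the catenary degree of $S$ satisfies $\mathsf{c}(S)\le 4$.
   Context: $\mathbb{N}$ is the set of non-negative integers. For a non-empty set $I\subseteq\mathbb{N}$, $\mathbb{N}^{(I)}$ is the additive monoid (componentwise addition) of all sequences $(n_i)_{i\in I}$ of non-negative integers with $n_i=0$ for all but finitely many $i$; $\mathbf{0}$ is the zero sequence. For $X,Y\subseteq\mathbb{N}^{(I)}$, $X+Y=\{x+y: x\in X,\ y\in Y\}$ and $2X=X+X$. For a submonoid $S$ of $\mathbb{N}^{(I)}$: $S^*=S\setminus\{\mathbf{0}\}$; $\mathcal{H}(S)=\mathbb{N}^{(I)}\setminus S$ is the set of gaps; $\mathcal{A}(S)=S^*\setminus(S^*+S^* )$ is the set of atoms. A submonoid $S$ of $\mathbb{N}^{(I)}$ is gap absorbing if $2\mathcal{H}(S)\subseteq\mathcal{H}(S)\cup\mathcal{A}(S)\cup 2\mathcal{A}(S)$ and $\mathcal{H}(S)+\mathcal{A}(S)\subseteq\mathcal{A}(S)\cup 2\mathcal{A}(S)$. For $\mathbf{s}\in S$, the set of factorizations of $\mathbf{s}$ is $\mathsf{Z}(\mathbf{s})=\{(\lambda_{\mathbf{a}})_{\mathbf{a}\in\mathcal{A}(S)}\in\mathbb{N}^{(\mathcal{A}(S))}:\sum_{\mathbf{a}}\lambda_{\mathbf{a}}\mathbf{a}=\mathbf{s}\}$ (finitely supported families). For $\mathbf{u}=(\lambda_{\mathbf{a}})$,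 $\mathbf{v}=(\mu_{\mathbf{a}})$ in $\mathbb{N}^{(\mathcal{A}(S))}$, put $|\mathbf{u}|=\sum_{\mathbf{a}}\lambda_{\mathbf{a}}$, let $\mathbf{u}\wedge\mathbf{v}=(\min(\lambda_{\mathbf{a}},\mu_{\mathbf{a}}))_{\mathbf{a}}$, and $\operatorname{d}(\mathbf{u},\mathbf{v})=\max\{|\mathbf{u}-(\mathbf{u}\wedge\mathbf{v})|,|\mathbf{v}-(\mathbf{u}\wedge\mathbf{v})|\}$. For $\mathbf{u},\mathbf{v}\in\mathsf{Z}(\mathbf{s})$, an $N$-chain joining them is a sequence $\mathbf{u}_1=\mathbf{u},\dots,\mathbf{u}_n=\mathbf{v}$ in $\mathsf{Z}(\mathbf{s})$ with $\operatorname{d}(\mathbf{u}_i,\mathbf{u}_{i+1})\le N$ for all $i\in\{1,\dots,n-1\}$. The catenary degree $\mathsf{c}(\mathbf{s})$ is the minimum positive integer $N$ such that any two factorizations of $\mathbf{s}$ are joined by an $N$-chain, and $\mathsf{c}(S)=\sup\{\mathsf{c}(\mathbf{s}):\mathbf{s}\in S\}$. *)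

(* Defs.v *)
From HB Require Import structures.
From mathcomp Require Import all_boot all_order all_algebra.
From mathcomp Require Import finmap multiset.
From mathcomp Require Import boolp classical_sets reals constructive_ereal ereal.

Set Implicit Arguments.
Unset Strict Implicit.
Unset Printing Implicit Defensive.

Import Order.TTheory GRing.Theory Num.Theory.

Local Open Scope classical_set_scope.
Local Open Scope ring_scope.

(* [multiset K] is the type of finitely supported functions [K -> nat]; it
   models the free commutative monoid N^(K), with multiset sum as addition. *)
Section MultisetNmodule.
Variable K : choiceType.
Implicit Types u v w : multiset K.

Let addA : associative (@msetD K : multiset K -> multiset K -> multiset K).
Proof. exact: msetDA. Qed.

Let addC : commutative (@msetD K : multiset K -> multiset K -> multiset K).
Proof. exact: msetDC. Qed.

Let add0 :
  left_id (mset0 : multiset K)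
          (@msetD K : multiset K -> multiset K -> multiset K).
Proof. exact: mset0D. Qed.

HB.instance Definition _ := Choice.on (multiset K).
HB.instance Definition _ := GRing.isNmodule.Build (multiset K) addA addC add0.

End MultisetNmodule.

(* N^(A) for a set [A] *)
Definition finfam (T : choiceType) (A : set T) : Type := multiset (set_type A).
Identity Coercion multiset_of_finfam : finfam >-> multiset.

Section Sumset.
Variable V : nmodType.

Definition sumset (X Y : set V) : set V := [set x + y | x in X & y in Y].

Definition twice (X : set V) : set V := sumset X X.

End Sumset.

Section GapAbsorbing.
Variable I : set nat.
Implicit Types S : set (finfam I).

Definition submonoid S : Prop :=
  S 0 /\ forall x y, S x -> S y -> S (x + y).

Definition nonzero S : set (finfam I) := S `\ 0.

Definition gaps S : set (finfam I) := ~` S.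

Definition atoms S : set (finfam I) :=
  nonzero S `\` sumset (nonzero S) (nonzero S).

Definition gap_absorbing S : Prop :=
  [/\ submonoid S,
      twice (gaps S) `<=` gaps S `|` atoms S `|` twice (atoms S)
    & sumset (gaps S) (atoms S) `<=` atoms S `|` twice (atoms S)].

End GapAbsorbing.

Section Distance.
Variable K : choiceType.
Implicit Types u v w : multiset K.

Definition flength u : nat := (\sum_(a <- finsupp u) u a)%N.

(* [msetI] is the pointwise minimum and [msetB] the pointwise truncated
   difference, which is exact here as [msetI u v] lies below [u] and [v]. *)
Definition fdist u v : nat :=
  maxn (flength (msetB u (msetI u v))) (flength (msetB v (msetI u v))).

Lemma flength_widen u (A : {fset K}) :
  fsubset (finsupp u) A -> flength u = (\sum_(a <- A) u a)%N.
Proof.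
move=> uA; rewrite /flength (big_fset_incl _ uA) // => a _ au.
by apply/eqP; rewrite -memNfinsupp.
Qed.

Lemma flengthD u v : flength (u + v) = (flength u + flength v)%N.
Proof.
set A := fsetU (finsupp (u + v)) (fsetU (finsupp u) (finsupp v)).
have sA w : fsubset (finsupp w) (fsetU (finsupp u) (finsupp v)) ->
    fsubset (finsupp w) A by move=> h; apply: fsubset_trans h (fsubsetUr _ _).
rewrite (@flength_widen (u + v) A) ?fsubsetUl//.
rewrite (@flength_widen u A) ?sA ?fsubsetUl//.
rewrite (@flength_widen v A) ?sA ?fsubsetUr// -big_split /=.
by apply: eq_bigr => a _; rewrite -[LHS]/(msetD u v a) msetE2.
Qed.

Lemma flength0 : flength 0 = 0%N.
Proof. by rewrite /flength finsupp0 big_seq_fset0. Qed.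

Lemma flength_gt0 u : u <> 0 -> (0 < flength u)%N.
Proof.
move=> u0; rewrite lt0n; apply/negP => /eqP lu; apply: u0.
by apply/eqP; rewrite -[_ == _]size_mset_eq0 size_mset; apply/eqP.
Qed.

Lemma flengthMn u n : flength (u *+ n) = (n * flength u)%N.
Proof. by elim: n => [|n IHn]; rewrite ?mulr0n ?flength0// mulrS flengthD IHn. Qed.

Lemma flength_sum (J : Type) (r : seq J) (F : J -> multiset K) :
  flength (\sum_(j <- r) F j) = (\sum_(j <- r) flength (F j))%N.
Proof. exact: (big_morph flength flengthD flength0). Qed.

Lemma flengthB u w : (flength (msetB u (msetI u w)) <= flength u)%N.
Proof.
have {3}-> : u = msetB u (msetI u w) + msetI u w; last by rewrite flengthD leq_addr.
by apply/msetP => a; rewrite -[RHS]/(msetD _ _ a) !msetE2 subnK ?geq_minl.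
Qed.

Lemma fdist_le u v : (fdist u v <= maxn (flength u) (flength v))%N.
Proof.
rewrite /fdist geq_max !leq_max flengthB /=.
suff -> : msetI u v = msetI v u by rewrite flengthB orbT.
by apply/msetP => a; rewrite !msetE2 minnC.
Qed.

End Distance.

Section Catenary.
Variables (I : set nat) (S : set (finfam I)).

Definition fvalue (u : finfam (atoms S)) : finfam I :=
  \sum_(a <- finsupp u) val a *+ u a.

Definition factorizations (s : finfam I) : set (finfam (atoms S)) :=
  [set u | fvalue u = s].

Definition chain_joined (N : nat) (s : finfam I) (u v : finfam (atoms S)) :=
  exists p : seq (finfam (atoms S)),
    [/\ forall w, w \in u :: p -> factorizations s w,
        path (fun x y => fdist x y <= N)%N u p
      & last u p = v].

Definition chain_bound (s : finfam I) (N : nat) : Prop :=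
  (0 < N)%N /\
  forall u v, factorizations s u -> factorizations s v -> chain_joined N s u v.

Lemma flength_factorization (s : finfam I) (u : finfam (atoms S)) :
  factorizations s u -> (flength u <= flength s)%N.
Proof.
move=> <-; rewrite /fvalue flength_sum /flength.
apply: leq_sum => a _; rewrite -/(flength _) flengthMn leq_pmulr//.
by apply: flength_gt0; have := set_mem (valP a) => -[[]].
Qed.

(* Any two factorizations of [s] are at distance at most [flength s], so the
   minimum defining the catenary degree of [s] is always attained. *)
Lemma chain_bound_exists (s : finfam I) :
  exists N, `[< chain_bound s N >].
Proof.
exists (maxn 1 (flength s)); apply/asboolP; split=> [|u v us vs].
  by rewrite leq_max.
exists [:: v]; split=> //= [w|].
  by rewrite !inE => /orP[] /eqP ->.
rewrite andbT (leq_trans (fdist_le _ _))// leq_max !geq_max.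
by rewrite (flength_factorization us) (flength_factorization vs) orbT.
Qed.

Definition catenary_degree_elt (s : finfam I) : nat :=
  ex_minn (chain_bound_exists s).

(* The supremum may a priori be infinite; [R] only hosts the naturals. *)
Definition catenary_degree (R : realType) : \bar R :=
  ereal_sup [set ((catenary_degree_elt s)%:R)%:E | s in S].

End Catenary.

(* Main.v *)
Require Import Defs.
From mathcomp Require Import all_boot all_order all_algebra.
From mathcomp Require Import finmap multiset.
From mathcomp Require Import boolp classical_sets reals constructive_ereal ereal.

Set Implicit Arguments.
Unset Strict Implicit.
Unset Printing Implicit Defensive.

Import Order.TTheory GRing.Theory Num.Theory.

(* Induct on [s], showing that [3] already bounds its catenary degree: two
   factorizations of [s] with a common atom are joined by the inductive
   hypothesis, so it suffices to join each [u] either to [v] or to a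
   factorization of length at most [3], since two of those are at distance at
   most [3].  If [u = t + w] with [t] a sum of three atoms and [w <> 0], and [t]
   is a sum of at most two atoms, then [u] can be shortened.  Otherwise gap
   absorption shows that [t - x] is in [S] whenever [x <= t] is a gap or an
   atom.  Splitting an atom [b] of [v] along [s = t + fvalue w] then yields an
   atom [p] dividing [t] with [p + b <= s].  Now [u] is joined to a
   factorization containing [p]; if [s - p - b] is in [S], this one is joined to
   [v] through a factorization containing both [p] and [b], and if it is a gap,
   [s - p = (s - p - b) + b] is a sum of at most two atoms. *)

(** * Free commutative monoids: cancellation, distance and refinement *)

Section MultisetMonoid.
Local Open Scope ring_scope.
Variable K : choiceType.
Implicit Types u v w : multiset K.

Lemma msetDE u v a : (u + v) a = (u a + v a)%N.
Proof. by rewrite -[LHS]/(msetD u v a) msetE2. Qed.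

Lemma mset_addrI u v w : u + v = u + w -> v = w.
Proof.
move=> /msetP e; apply/msetP => a.
by have := e a; rewrite !msetDE => /addnI.
Qed.

Lemma fdistC u v : fdist u v = fdist v u.
Proof. by rewrite /fdist maxnC msetIC. Qed.

Lemma fdistDr u v w : fdist (u + w) (v + w) = fdist u v.
Proof.
have eB x y : msetB (x + w) (msetI (x + w) (y + w)) = msetB x (msetI x y).
  by apply/msetP => a; rewrite !(msetE2, msetDE) -addn_minl subnDr.
by rewrite /fdist eB (msetIC (u + w)) eB (msetIC v).
Qed.

Lemma flength1 a : flength ([mset a]%mset : multiset K) = 1%N.
Proof. by rewrite /flength finsupp_msetn /= big_seq_fset1 msetnxx. Qed.

Lemma flength_gt0_split u :
  (0 < flength u)%N -> exists a u', u = [mset a]%mset + u'.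
Proof.
case: (pselect (exists a, a \in finsupp u)) => [[a au] _|no].
  exists a, (msetB u [mset a]%mset); rewrite -[RHS]/(msetD _ _) msetB1K //.
  by rewrite -msuppE.
rewrite /flength big1_seq // => a /andP[_ au].
by case: no; exists a.
Qed.

(** Riesz refinement of two decompositions of one element: [y] is the pointwise minimum of [u] and
    [w], and the other parts are what remains. *)
Lemma mset_add_split u v w x : u + v = w + x ->
  exists y u' w' x', [/\ u = y + u', w = y + w' & x = u' + x'].
Proof.
move=> /msetP e.
exists (msetI u w), (msetB u (msetI u w)), (msetB w (msetI u w)).
exists (msetB x (msetB u (msetI u w))); split; apply/msetP => a;
  rewrite msetDE !msetE2; have := e a; rewrite !msetDE => ea.
- by rewrite subnKC // geq_minl.
- by rewrite subnKC // geq_minr.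
(* The excess of [u] over [w] fits below [x]: it is zero where [u a <= w a], and elsewhere
   [u a <= w a + x a] by [ea]. *)
- rewrite subnKC //; case: (leqP (u a) (w a)) => _; first by rewrite subnn.
  by rewrite leq_subLR -ea leq_addr.
Qed.

End MultisetMonoid.

(** * Factorizations into atoms *)

Section Factorizations.
Local Open Scope ring_scope.
Local Open Scope classical_set_scope.
Variables (I : set nat) (S : set (finfam I)).
Implicit Types (s x y : finfam I) (u v w : finfam (atoms S)).

Lemma fvalue_widen u (A : {fset set_type (atoms S)}) :
  fsubset (finsupp u) A -> fvalue u = \sum_(a <- A) val a *+ u a.
Proof.
move=> uA; rewrite /fvalue (big_fset_incl _ uA) // => a _ au.
suff -> : u a = 0%N by rewrite mulr0n.
by apply/eqP; rewrite -memNfinsupp.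
Qed.

Lemma fvalueD u v : fvalue (u + v : finfam (atoms S)) = fvalue u + fvalue v.
Proof.
set A := fsetU (finsupp (u + v)) (fsetU (finsupp u) (finsupp v)).
have sA w : fsubset (finsupp w) (fsetU (finsupp u) (finsupp v)) ->
    fsubset (finsupp w) A by move=> h; apply: fsubset_trans h (fsubsetUr _ _).
rewrite (@fvalue_widen (u + v) A) ?fsubsetUl//.
rewrite (@fvalue_widen u A) ?sA ?fsubsetUl//.
rewrite (@fvalue_widen v A) ?sA ?fsubsetUr// -big_split /=.
by apply: eq_bigr => a _; rewrite msetDE mulrnDr.
Qed.

Lemma fvalue0 : fvalue (0 : finfam (atoms S)) = 0.
Proof. by rewrite /fvalue finsupp0 big_seq_fset0. Qed.

Lemma fvalue1 (a : set_type (atoms S)) :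
  fvalue ([mset a]%mset : finfam (atoms S)) = val a.
Proof. by rewrite /fvalue finsupp_msetn /= big_seq_fset1 msetnxx mulr1n. Qed.

Lemma fvalue_atom x : atoms S x ->
  exists u, fvalue u = x /\ flength u = 1%N.
Proof.
move=> ax; exists [mset (SigSub (mem_set ax) : set_type (atoms S))]%mset.
by rewrite fvalue1 flength1.
Qed.

Lemma fvalue_short x : (atoms S `|` twice (atoms S)) x ->
  exists u, fvalue u = x /\ (flength u <= 2)%N.
Proof.
case=> [/fvalue_atom[u [ux lu]]|]; first by exists u; rewrite ux lu.
move=> [y /fvalue_atom[u [uy lu]]] [z /fvalue_atom[v [vz lv]]] <-.
by exists (u + v : finfam _); rewrite fvalueD uy vz flengthD lu lv.
Qed.

(** The coordinate sum is additive and positive off zero, so splitting a non-atom into two nonzero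
    elements of [S] lowers it on both sides, and repeated splitting stops. *)
Lemma factorization_exists x : S x -> exists u, fvalue u = x.
Proof.
have [n] := ubnP (flength x); elim: n x => // n IH x lx Sx.
have [->|x0] := pselect (x = 0); first by exists 0; exact: fvalue0.
have [/fvalue_atom[u [ux _]]|nx] := pselect (atoms S x); first by exists u.
have [y [Sy y0] [z [Sz z0] yz]] : sumset (nonzero S) (nonzero S) x.
  by apply: contrapT => h; apply: nx; split.
move: lx; rewrite -yz flengthD ltnS => lx.
have ly : (0 < flength y)%N by apply: flength_gt0.
have lz : (0 < flength z)%N by apply: flength_gt0.
have [u uy] : exists u, fvalue u = y.
  by apply: IH => //; apply: leq_trans lx; rewrite -addn1 leq_add2l.
have [v vz] : exists v, fvalue v = z.
  by apply: IH => //; apply: leq_trans lx; rewrite -add1n leq_add2r.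
by exists (u + v : finfam _); rewrite fvalueD uy vz.
Qed.

Lemma fvalue_in u : submonoid S -> S (fvalue u).
Proof.
move=> [S0 SD]; have [n] := ubnP (flength u); elim: n u => // n IH u.
have [l0 _|/flength_gt0_split[a [v ->]]] := posnP (flength u).
  suff -> : u = 0 by rewrite fvalue0.
  by apply: contrapT => /flength_gt0; rewrite l0.
rewrite flengthD flength1 add1n ltnS => lv; rewrite fvalueD fvalue1.
by apply: SD; [have := set_mem (valP a) => -[[]] | exact: IH].
Qed.

Lemma atom_divides x : submonoid S -> S x -> x <> 0 ->
  exists p y, [/\ atoms S p, S y & x = p + y].
Proof.
move=> Smon /factorization_exists[u <-] x0.
have [|a [v uE]] := @flength_gt0_split _ u.
  by apply: flength_gt0 => u0; apply: x0; rewrite u0 fvalue0.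
exists (val a), (fvalue v); rewrite uE fvalueD fvalue1; split=> //.
  exact: set_mem (valP a).
exact: fvalue_in.
Qed.

Lemma atom_sum_zero x y : atoms S (x + y) -> S x -> S y -> x = 0 \/ y = 0.
Proof.
move=> [_ nxy] Sx Sy; have [->|x0] := pselect (x = 0); first by left.
have [->|y0] := pselect (y = 0); first by right.
by case: nxy; exists x => //; exists y.
Qed.

End Factorizations.

(** * Chains of factorizations: equivalence and translation *)

Section Chains.
Local Open Scope ring_scope.
Local Open Scope classical_set_scope.
Variables (I : set nat) (S : set (finfam I)) (N : nat).
Implicit Types (s : finfam I) (u v w : finfam (atoms S)).

Lemma chain_joined_step s u v : factorizations s u -> factorizations s v ->
  (fdist u v <= N)%N -> chain_joined N s u v.
Proof.
move=> us vs uv; exists [:: v]; split=> //=; last by rewrite uv.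
by move=> w; rewrite !inE => /orP[] /eqP ->.
Qed.

Lemma chain_joined_refl s u : factorizations s u -> chain_joined N s u u.
Proof. by move=> us; exists [::]; split=> // w; rewrite inE => /eqP ->. Qed.

Lemma chain_joined_trans s u v w :
  chain_joined N s u v -> chain_joined N s v w -> chain_joined N s u w.
Proof.
move=> [p [ps pp pl]] [q [qs qp ql]]; exists (p ++ q); split.
- move=> x; rewrite -cat_cons mem_cat => /orP[/ps //|xq].
  by apply: qs; rewrite inE xq orbT.
- by rewrite cat_path pp pl qp.
- by rewrite last_cat pl.
Qed.

Lemma chain_joined_sym s u v : chain_joined N s u v -> chain_joined N s v u.
Proof.
move=> [p [ps pp <-]] {v}; elim: p u ps pp => [|v p IH] u ps /=.
  by move=> _; apply: chain_joined_refl; apply: ps; rewrite inE.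
move=> /andP[uv pp]; have us : factorizations s u by apply: ps; rewrite inE eqxx.
have vs : factorizations s v by apply: ps; rewrite !inE eqxx orbT.
apply: (@chain_joined_trans _ _ v).
  by apply: IH => // w wp; apply: ps; rewrite inE wp orbT.
by apply: chain_joined_step => //; rewrite fdistC.
Qed.

(** Adding [w] to every term of a chain keeps all its distances. *)
Lemma chain_joinedDr s u v w : chain_joined N s u v ->
  chain_joined N (s + fvalue w) (u + w : finfam _) (v + w : finfam _).
Proof.
move=> [p [ps pp <-]] {v}.
have trD x : factorizations s x -> factorizations (s + fvalue w) (x + w : finfam _).
  by rewrite /factorizations /= fvalueD => ->.
elim: p u ps pp => [|v p IH] u ps /=.
  by move=> _; apply: chain_joined_refl; apply/trD/ps; rewrite inE.
move=> /andP[uv pp]; have us : factorizations s u by apply: ps; rewrite inE eqxx.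
have vs : factorizations s v by apply: ps; rewrite !inE eqxx orbT.
apply: (@chain_joined_trans _ _ (v + w : finfam _)).
  by apply: chain_joined_step; rewrite ?fdistDr //; apply: trD.
by apply: IH => // x xp; apply: ps; rewrite inE xp orbT.
Qed.

End Chains.

(** * Gap absorption and the bound 3 *)

Section GapAbsorbingChains.
Local Open Scope ring_scope.
Local Open Scope classical_set_scope.
Variables (I : set nat) (S : set (finfam I)).
Hypothesis Sgap : gap_absorbing S.
Implicit Types (b c p s t x y z : finfam I) (u v w : finfam (atoms S)).

Let Smon : submonoid S. Proof. by case: Sgap. Qed.

Lemma finfam_addr_eq0 x y : x + y = 0 -> x = 0.
Proof.
move=> xy0; apply: contrapT => /flength_gt0.
have := congr1 (@flength _) xy0; rewrite flengthD flength0 => /eqP.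
by rewrite addn_eq0 => /andP[/eqP ->].
Qed.

Lemma gap_addl_atom g p : gaps S g -> atoms S p ->
  (atoms S `|` twice (atoms S)) (p + g).
Proof.
by move=> hg ap; case: Sgap => _ _; apply; exists g => //; exists p; rewrite // addrC.
Qed.

Lemma short_in x : (atoms S `|` twice (atoms S)) x -> S x.
Proof. by move=> /fvalue_short[u [<- _]]; exact: fvalue_in. Qed.

(** Were [y] a gap, [t] would be a sum of two gaps or of a gap and an atom, and absorption would
    make it a sum of at most two atoms. Were [y] zero, [t] would itself be a gap or an atom. *)
Lemma gap_or_atom_complement t x y : S t ->
    ~ (atoms S `|` twice (atoms S)) t -> t = x + y ->
    gaps S x \/ atoms S x -> S y /\ y <> 0.
Proof.
move=> St nt tE hx; split.
  apply: contrapT => ny; case: hx => [gx|ax]; last first.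
    by apply: nt; rewrite tE; exact: gap_addl_atom.
  case: Sgap => _ /(_ t) h _; have : twice (gaps S) t by exists x => //; exists y.
  by move=> /h [[/(_ St)|at_]|tt] //; apply: nt; [left|right].
move=> y0; move: tE; rewrite y0 addr0 => tE.
by case: hx; rewrite -tE => // at_; apply: nt; left.
Qed.

(* If [y <> 0], it is a gap.  Were [x = q + q' + r'] with atoms [q] and [q'],
   then [q' + y] would lie in [S], and [q + (q' + y + r')] would split [x + y]. *)
Lemma atom_part_atom x y : atoms S (x + y) -> S x -> x <> 0 -> atoms S x.
Proof.
move=> axy Sx x0; have [y0|y0] := pselect (y = 0); first by rewrite y0 addr0 in axy.
have gy : gaps S y by move=> /(atom_sum_zero axy Sx)[].
have [q [r [aq Sr xE]]] := atom_divides Smon Sx x0.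
have [r0|r0] := pselect (r = 0); first by rewrite xE r0 addr0.
have [q' [r' [aq' Sr' rE]]] := atom_divides Smon Sr r0.
have Sq'y : S (q' + y) by apply/short_in/gap_addl_atom.
have q0 z : atoms S z -> z <> 0 by move=> [[]].
exfalso; have : atoms S (q + (q' + y + r')) by move: axy; rewrite xE rE -!addrA (addrC r').
move=> /atom_sum_zero; case; [by case: aq => -[]|exact: Smon.2|exact: q0|].
by rewrite -addrA => /finfam_addr_eq0; exact: q0.
Qed.

(** Refining [b + c = t + x] shows that the part of [t] outside [b] lies below both [t] and [c], and
    hence so does any atom dividing it. The remainder [z] of [c] may be a gap. *)
Lemma exchange_atom b c t x : atoms S b -> S t -> t <> 0 ->
    ~ (atoms S `|` twice (atoms S)) t -> b + c = t + x ->
  exists p y z, [/\ atoms S p, S y, t = p + y & c = p + z].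
Proof.
move=> ab St t0 nt bctx.
have [d [d' [e [f [bE tE xE]]]]] := mset_add_split bctx.
have cE : c = e + f.
  apply: (@mset_addrI _ (d + d')).
  by rewrite -[in LHS]bE bctx tE xE addrACA.
(* The part [e] of [t] outside [b] is a nonzero element of [S]: any of its atoms
   serves as [p]. *)
have [Se e0] : S e /\ e <> 0.
  have [d0|d0] := pselect (d = 0); first by move: tE; rewrite d0 add0r => <-.
  apply: (gap_or_atom_complement St nt tE).
  (* As a nonzero part of the atom [b], [d] is a gap or again an atom. *)
  have [Sd|gd] := pselect (S d); last by left.
  by right; apply: (@atom_part_atom d d') => //; rewrite -bE.
have [p [e' [ap _ eE]]] := atom_divides Smon Se e0.
have tE' : t = p + (d + e') by rewrite tE eE addrCA.
exists p, (d + e'), (e' + f); split=> //; last by rewrite cE eE addrA.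
by have [] := gap_or_atom_complement St nt tE' (or_intror ap).
Qed.

(** Stripping the common part [w] leaves two factorizations of a strictly smaller element; their
    chain is then translated back by [w]. *)
Lemma chain_joined_common s u v w :
    (forall s', (flength s' < flength s)%N -> forall u v,
      factorizations s' u -> factorizations s' v -> chain_joined 3 s' u v) ->
    w <> 0 -> fvalue u = fvalue v -> s = fvalue u + fvalue w ->
  chain_joined 3 s (u + w : finfam _) (v + w : finfam _).
Proof.
move=> IH w0 uv sE; rewrite sE; apply: chain_joinedDr; apply: IH => //.
rewrite sE flengthD -addn1 leq_add2l.
by apply: leq_trans (flength_factorization (erefl (fvalue w))); exact: flength_gt0.
Qed.

Lemma chain_joined_or_short s u v :
    (forall s', (flength s' < flength s)%N -> forall u v,
      factorizations s' u -> factorizations s' v -> chain_joined 3 s' u v) ->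
    factorizations s u -> factorizations s v ->
  chain_joined 3 s u v \/
  exists u', [/\ chain_joined 3 s u u', factorizations s u' & (flength u' <= 3)%N].
Proof.
move=> IH; have [n] := ubnP (flength u); elim: n u => // n IHn u lu us vs.
have [u3|u4] := leqP (flength u) 3.
  by right; exists u; split=> //; exact: chain_joined_refl.
have [|a1 [u1 uE1]] := @flength_gt0_split _ u; first exact: leq_trans u4.
rewrite uE1 flengthD flength1 add1n ltnS in u4.
have [|a2 [u2 uE2]] := @flength_gt0_split _ u1; first exact: leq_trans u4.
rewrite uE2 flengthD flength1 add1n ltnS in u4.
have [|a3 [w uE3]] := @flength_gt0_split _ u2; first exact: leq_trans u4.
rewrite uE3 flengthD flength1 add1n ltnS in u4.
(* Three atoms have been removed from at least four, so [u4] now says that [w] has positive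
   length. *)
have w0 : w <> 0 by move=> w0; rewrite w0 flength0 in u4.
pose t3 : finfam (atoms S) := ([mset a1] + ([mset a2] + [mset a3]))%mset.
have l3 : flength t3 = 3%N by rewrite /t3 !flengthD !flength1.
have uE : u = t3 + w by rewrite uE1 uE2 uE3 /t3 !addrA.
clearbody t3.
have sE : s = fvalue t3 + fvalue w by rewrite -fvalueD -uE -us.
have join r : fvalue r = fvalue t3 -> chain_joined 3 s u (r + w : finfam _).
  by move=> rt; rewrite uE; apply: chain_joined_common.
have facts r : fvalue r = fvalue t3 -> factorizations s (r + w : finfam _).
  by move=> rt; rewrite /factorizations /= fvalueD rt.
have [/fvalue_short[r [rt lr]]|nt] :=
    pselect ((atoms S `|` twice (atoms S)) (fvalue t3)).
  (* At most two atoms replace three, so the induction on the length of [u] applies to [r + w]. *)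
  have lrw : (flength (r + w)%R < n)%N.
    by move: lu; rewrite uE !flengthD l3 !ltnS; apply: leq_trans; rewrite ltn_add2r.
  have [jv|[u' [ju' us' lu']]] := IHn _ lrw (facts r rt) vs.
  - by left; exact: (chain_joined_trans (join r rt) jv).
  - by right; exists u'; split=> //; exact: (chain_joined_trans (join r rt) ju').
have t0 : fvalue t3 <> 0.
  move=> t0; have := flength_factorization (erefl (fvalue t3)).
  by rewrite t0 flength0 l3.
have [|b [v' vE]] := @flength_gt0_split _ v.
  apply: flength_gt0 => v0; apply: t0; apply: (@finfam_addr_eq0 _ (fvalue w)).
  by rewrite -sE -vs v0 fvalue0.
have sEb : s = val b + fvalue v' by rewrite -vs vE fvalueD fvalue1.
have ab : atoms S (val b) := set_mem (valP b).
have [p [y [z [ap Sy tE v'E]]]] :=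
  exchange_atom ab (fvalue_in t3 Smon) t0 nt (etrans (esym sEb) sE).
have [P [Pp lP]] := fvalue_atom ap.
have P0 : P <> 0 by move=> P0; rewrite P0 flength0 in lP.
have [Y Yy] := factorization_exists Sy.
have tE' : fvalue (P + Y : finfam _) = fvalue t3 by rewrite fvalueD Pp Yy.
have PYw : (P + Y : finfam _) + w = (Y + w) + P :> finfam (atoms S).
  by rewrite -addrA addrC.
have sEP : s = fvalue (Y + w : finfam _) + fvalue P.
  by rewrite -fvalueD -PYw fvalueD tE'.
have jP := join _ tE'; rewrite PYw in jP.
have restE : fvalue (Y + w : finfam _) = val b + z.
  apply: (@mset_addrI _ p); rewrite -{1}Pp addrC -sEP sEb v'E.
  exact: addrCA.
(* If [z] is in [S], the chain passes through [[mset b] + Z + P], which shares [P] with the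
   factorization before it and [b] with [v]. *)
have [Sz|gz] := pselect (S z).
  have [Z Zz] := factorization_exists Sz.
  left; apply: (chain_joined_trans jP).
  have vE' : fvalue (Z + P : finfam _) = fvalue v'.
    by rewrite fvalueD Zz Pp v'E addrC.
  apply: (@chain_joined_trans _ _ _ _ _ (([mset b]%mset + Z) + P : finfam _)).
    by apply: chain_joined_common => //; rewrite restE fvalueD fvalue1 Zz.
  rewrite -addrA vE addrC [X in chain_joined _ _ _ X]addrC.
  apply: chain_joined_common => //.
    by move=> b0; have := flength1 b; rewrite b0 flength0.
  by rewrite fvalue1 vE' sEb addrC.
(* Here [b + z] is an atom plus a gap, so it has a factorization of length at most 2; adding [P]
   gives length at most 3. *)
have [R [Rr lR]] := fvalue_short (gap_addl_atom gz ab).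
right; exists (R + P : finfam _); split.
- by apply: (chain_joined_trans jP); apply: chain_joined_common => //; rewrite Rr.
- by rewrite /factorizations /= fvalueD Rr -restE -sEP.
- by rewrite flengthD lP addn1.
Qed.

Lemma chain_joined3 s u v :
  factorizations s u -> factorizations s v -> chain_joined 3 s u v.
Proof.
have [n] := ubnP (flength s); elim: n s u v => // n IHn s u v ls us vs.
have IH s' : (flength s' < flength s)%N -> forall u v,
    factorizations s' u -> factorizations s' v -> chain_joined 3 s' u v.
  by move=> ls' u' v'; apply: IHn; apply: leq_trans ls' _.
have [//|[u' [uu' us' lu']]] := chain_joined_or_short IH us vs.
have [/chain_joined_sym //|[v' [vv' vs' lv']]] := chain_joined_or_short IH vs us.
apply: (chain_joined_trans uu').
apply: chain_joined_trans (chain_joined_sym vv').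
apply: chain_joined_step => //; apply: leq_trans (fdist_le _ _) _.
by rewrite geq_max lu'.
Qed.

End GapAbsorbingChains.

Theorem theorem4p4 (R : realType) (I : set nat) (S : set (finfam I)) :
  (I !=set0)%classic -> gap_absorbing S -> (catenary_degree S R <= 4%:E)%E.
Proof.
move=> _ Sgap; apply: ge_ereal_sup => _ [s _ <-]; rewrite lee_fin ler_nat.
(* By minimality it suffices that 4 is a chain bound, and every 3-chain is a 4-chain. *)
rewrite /catenary_degree_elt; case: ex_minnP => m _; apply.
apply/asboolP; split=> // u v us vs.
have [p [ps pp pl]] := chain_joined3 Sgap us vs.
by exists p; split=> //; apply: sub_path pp => x y /leq_trans; apply.
Qed.
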